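(* Let $\Psi=\{\psi_k\}_{k=1}^\infty$ be an orthonormal basis of a real Hilbert space $H$, and let $\tau=\{t_k\}_{k=1}^\infty$, $t_k\in[0,1]$, be a weakness sequence. Then the condition $$\sum_{k=1}^\infty t_k=\infty$$ is necessary and sufficient for convergence of the Weak Thresholding Greedy Algorithm WTGA($\tau$) with respect to $\Psi$ for each element of $A_1(\Psi)$; that is, it holds if and only if for every $f\in A_1(\Psi)$ and every realization of WTGA($\tau$) applied to $f$ one has $\lim_{m\to\infty}\|f-G_m^\tau(f)\|=0$.
   Context: $A_1(\Psi)$ is the closure in $H$ of the convex hull of $\{\pm\psi_k: k\ge1\}$. For $f\in H$ let $c_k(f,\Psi)=\langle f,\psi_k\rangle$ be the coefficients of the expansion $f=\sum_{k=1}^\infty c_k(f,\Psi)\psi_k$. Weak Thresholding Greedy Algorithm WTGA($\tau$): put $f_0^\tau=f$, $G_0^\tau(f)=0$. At the $m$th iteration ($m\ge1$), choose any index $k_m$ such that $|c_{k_m}(f_{m-1}^\tau,\Psi)|\ge t_m\max_k|c_k(f_{m-1}^\tau,\Psi)|$, and define $G_m^\tau(f)=G_{m-1}^\tau(f)+c_{k_m}(f_{m-1}^\tau,\Psi)\psi_{k_m}$ and $f_m^\tau=f-G_m^\tau(f)$. A realization is any outcome of admissible choices of the indices $k_m$. *)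

(* Defs.v *)
From HB Require Import structures.
From mathcomp Require Import all_boot all_order all_algebra.
From mathcomp Require Import all_classical all_reals all_analysis.

Set Implicit Arguments.
Unset Strict Implicit.
Unset Printing Implicit Defensive.

Import Order.TTheory GRing.Theory Num.Theory.
Import numFieldNormedType.Exports.

Local Open Scope classical_set_scope.
Local Open Scope ring_scope.

(* A real Hilbert space is a complete normed module [H] over a [realType],
   together with a symmetric positive definite bilinear form
   [dot : {dot H for idfun}] that induces the norm of [H].

   Sequences that are indexed from 1 in the mathematics are indexed from 0
   here: [psi k], [t m] and [kk m] stand for psi_{k+1}, t_{m+1} and k_{m+1}. *)

Definition induces_norm (R : realType) (H : completeNormedModType R)
    (dot : {dot H for idfun}) : Prop :=
  forall x : H, `|x| ^+ 2 = dot x x.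

Definition orthonormal_basis (R : realType) (H : completeNormedModType R)
    (dot : {dot H for idfun}) (psi : nat -> H) : Prop :=
  (forall j k : nat, dot (psi j) (psi k) = (j == k)%:R) /\
  (forall f : H, series (fun k => dot f (psi k) *: psi k) @ \oo --> f).

Definition convex_hull (R : realType) (M : lmodType R) (A : set M) : set M :=
  smallest (@convex_set R M) A.

Definition A1 (R : realType) (H : completeNormedModType R)
    (psi : nat -> H) : set H :=
  closure (convex_hull [set g | exists k, g = psi k \/ g = - psi k]).

(* The supremum is attained: see [coef_max_attained] below. *)
Definition coef_max (R : realType) (H : completeNormedModType R)
    (dot : {dot H for idfun}) (psi : nat -> H) (g : H) : R :=
  sup (range (fun k => `|dot g (psi k)|)).

Fixpoint wtga_approx (R : realType) (H : completeNormedModType R)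
    (dot : {dot H for idfun}) (psi : nat -> H) (f : H) (kk : nat -> nat)
    (m : nat) : H :=
  if m is n.+1 then
    let G := wtga_approx dot psi f kk n in
    G + dot (f - G) (psi (kk n)) *: psi (kk n)
  else 0.

Definition wtga_realization (R : realType) (H : completeNormedModType R)
    (dot : {dot H for idfun}) (psi : nat -> H) (t : nat -> R) (f : H)
    (kk : nat -> nat) : Prop :=
  forall m : nat,
    let fm := f - wtga_approx dot psi f kk m in
    `|dot fm (psi (kk m))| >= t m * coef_max dot psi fm.

Lemma coef_cvg0 (R : realType) (H : completeNormedModType R)
    (dot : {dot H for idfun}) (psi : nat -> H) :
  induces_norm dot -> orthonormal_basis dot psi ->
  forall g : H, (fun k => `|dot g (psi k)|) @ \oo --> (0 : R).
Proof.
move=> nd [on ex] g.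
have n1 k : `|psi k| = 1.
  by apply/eqP; rewrite -(@pexpr_eq1 _ _ 2)// nd on eqxx.
have c0 : (fun k => dot g (psi k) *: psi k) @ \oo --> (0 : H).
  by apply: cvg_series_cvg_0; apply/cvg_ex; exists g; exact: ex.
rewrite (_ : (fun k => _) = (fun k => `|dot g (psi k) *: psi k|)).
  by rewrite -[0 in X in _ --> X](@normr0 _ H); exact: cvg_norm.
by apply/funext => k; rewrite normrZ n1 mulr1.
Qed.

Lemma coef_max_attained (R : realType) (H : completeNormedModType R)
    (dot : {dot H for idfun}) (psi : nat -> H) :
  induces_norm dot -> orthonormal_basis dot psi ->
  forall g : H, exists j, coef_max dot psi g = `|dot g (psi j)| /\
    forall k, `|dot g (psi k)| <= `|dot g (psi j)|.
Proof.
move=> nd ob g; have c0 := coef_cvg0 nd ob g.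
suff [j jP] : exists j, forall k, `|dot g (psi k)| <= `|dot g (psi j)|.
  exists j; split => //; apply/eqP; rewrite eq_le; apply/andP; split.
    apply: ge_sup; first by exists `|dot g (psi j)|, j.
    by move=> _ [k _ <-].
  apply: ub_le_sup; last by exists j.
  by exists `|dot g (psi j)| => _ [k _ <-].
have [[k0 k0P]|nz] := pselect (exists k0, dot g (psi k0) != 0); last first.
  exists 0%N => k; have -> : dot g (psi k) = 0; last by rewrite normr0.
  by apply/eqP; apply/negPn/negP => kn; apply: nz; exists k.
have /cvgr0_norm_lt /(_ `|dot g (psi k0)|) := c0.
rewrite normr_gt0 => /(_ k0P) [N _ NP].
pose n := (maxn N k0).+1.
have k0n : (k0 < n)%N by rewrite ltnS leq_maxr.
case: (@arg_maxP _ _ _ (Ordinal k0n) xpredT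
  (fun i : 'I_n => `|dot g (psi i)|)) => //= j _ jP.
exists j => k; case: (ltnP k n) => [kn|nk]; first exact: (jP (Ordinal kn)).
have /NP/= : (N <= k)%N by rewrite (leq_trans _ nk)// ltnW// ltnS leq_maxl.
by rewrite normr_id => /ltW /le_trans; apply; exact: (jP (Ordinal k0n)).
Qed.

(* Main.v *)
(* An element of [A1 psi] has coefficients of l1 norm at most 1. A step of the
   algorithm deletes one coefficient of the residual, so the moduli of the
   coefficients deleted along the way add up to at most 1; since the m-th one is
   at least [t m] times the largest residual coefficient [M m], the sum of
   [t m * M m] is at most 1. If the [t m] have infinite sum, the nonincreasing
   sequence [M] tends to 0, and so does the residual, whose squared norm is at
   most [M m] times its l1 norm.
   If the [t m] sum to at most [C], take [c = 1 / (1 + C)] and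
   [f = c psi_0 + sum_m c t_m psi_(m+1)]: selecting index [m + 1] at step [m]
   is admissible, and the coefficient [c] at index 0 is never removed. *)

Require Import Defs.
From HB Require Import structures.
From mathcomp Require Import all_boot all_order all_algebra.
From mathcomp Require Import all_classical all_reals all_analysis.
Import Order.TTheory GRing.Theory Num.Theory.
Import numFieldNormedType.Exports.
Local Open Scope classical_set_scope.
Local Open Scope ring_scope.

(** Trades divergence in the extended reals for unbounded partial sums, the form used in both
    directions. *)
Lemma nneseries_pinftyP (R : realType) (u : nat -> R) :
  (forall n, 0 <= u n) ->
  (\sum_(0 <= m <oo) (u m)%:E = +oo)%E <->
  ~ exists C, forall n, \sum_(i < n) u i <= C.
Proof.
move=> u0; have uE0 n : (0 <= n)%N -> true -> (0 <= (u n)%:E)%E.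
  by rewrite lee_fin.
split=> [uoo [C uC]|nub].
  suff : (\sum_(0 <= m <oo) (u m)%:E <= C%:E)%E by rewrite uoo leye_eq.
  apply: lime_le; first exact: is_cvg_nneseries.
  by apply: nearW => n; rewrite sumEFin lee_fin big_mkord.
apply: contrapT => /eqP uNoo; apply: nub.
have ufin : (\sum_(0 <= m <oo) (u m)%:E)%E \is a fin_num.
  by rewrite ge0_fin_numE ?ltey//; exact: nneseries_ge0.
exists (fine (\sum_(0 <= m <oo) (u m)%:E)%E) => n.
rewrite -lee_fin fineK// -(big_mkord xpredT u) -sumEFin.
exact: nneseries_lim_ge.
Qed.

(** * Convex combinations in a convex hull *)

Section ConvexHull.
Context {R : realType} {M : lmodType R}.

Lemma convex_hull_conv (A : set M) (x y : M) (p : R) : 0 <= p <= 1 ->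
  convex_hull A x -> convex_hull A y ->
  convex_hull A (p *: x + (1 - p) *: y).
Proof.
move=> /andP[p0 p1] Ax Ay B [cB AB].
have := @cB x y (Itv01 p0 p1).
by rewrite !inE; apply; [exact: Ax|exact: Ay].
Qed.

(** The weight missing from 1 is carried by 0. The induction splits off the last term with weight
    [p] and rescales the others by [1 / (1 - p)], which keeps their sum at most 1. *)
Lemma convex_hull_sub1sum (A : set M) (e : nat -> M) (a : nat -> R) n :
  convex_hull A 0 -> (forall i, A (e i)) -> (forall i, 0 <= a i) ->
  \sum_(i < n) a i <= 1 -> convex_hull A (\sum_(i < n) a i *: e i).
Proof.
move=> A0 Ae; elim: n a => [|n IHn] a a0; first by rewrite !big_ord0.
rewrite !big_ord_recr/= addrC => a1; set p := a n.
have s0 : 0 <= \sum_(i < n) a i by apply: sumr_ge0.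
have p1 : p <= 1 by apply: le_trans a1; rewrite lerDl.
have sq : \sum_(i < n) a i <= 1 - p by rewrite lerBrDl.
have q0 : 0 <= 1 - p by rewrite subr_ge0.
rewrite [X in _ X](_ : _ =
    p *: e n + (1 - p) *: \sum_(i < n) (a i / (1 - p)) *: e i); last first.
  rewrite addrC; congr (_ + _); rewrite scaler_sumr; apply: eq_bigr => i _.
  rewrite scalerA mulrC; congr (_ *: _).
  (* If [p = 1], the quotient is 0 by convention; nothing is lost, since the other weights all
     vanish. *)
  have [q_eq0|qN0] := eqVneq (1 - p) 0; last by rewrite divfK.
  rewrite q_eq0 mulr0; apply/eqP; rewrite eq_le a0 andbT -q_eq0.
  by apply: le_trans sq; rewrite (bigD1 i)//= lerDl sumr_ge0.
apply: convex_hull_conv; first by rewrite p1 a0.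
  by move=> B [_ AB]; exact: AB (Ae n).
apply: (IHn (fun i => a i / (1 - p))) => [i|]; first by rewrite divr_ge0.
rewrite -mulr_suml.
have [->|qN0] := eqVneq (1 - p) 0; first by rewrite invr0 mulr0.
by rewrite ler_pdivrMr ?mul1r// lt0r qN0.
Qed.

End ConvexHull.

(** * Coefficients in an orthonormal basis *)

Section OrthonormalBasis.
Context {R : realType} {H : completeNormedModType R}.
Context {dot : {dot H for idfun}} {psi : nat -> H}.
Hypothesis dot_norm : induces_norm dot.
Hypothesis psi_basis : orthonormal_basis dot psi.

Let psiE j k : dot (psi j) (psi k) = (j == k)%:R.
Proof. by case: psi_basis. Qed.

Let dotC x y : dot x y = dot y x.
Proof. by rewrite hermC expr0 mul1r. Qed.

Let dotDl z x y : dot (x + y) z = dot x z + dot y z.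
Proof. exact: linearDl. Qed.

Let dotBl z x y : dot (x - y) z = dot x z - dot y z.
Proof. exact: linearBl. Qed.

Let dotZl z a x : dot (a *: x) z = a * dot x z.
Proof. by rewrite linearZl_LR. Qed.

Let dotZr z a x : dot z (a *: x) = a * dot z x.
Proof. by rewrite dotC dotZl dotC. Qed.

Lemma norm_psi k : `|psi k| = 1.
Proof. by apply/eqP; rewrite -(@pexpr_eq1 _ _ 2)// dot_norm psiE eqxx. Qed.

(** Bessel for one vector: with [c] the k-th coefficient, [|g|^2 - c^2 = |g - c psi_k|^2]. *)
Lemma normr_coef_le g k : `|dot g (psi k)| <= `|g|.
Proof.
rewrite -ler_sqr ?nnegrE// real_normK ?num_real// dot_norm -subr_ge0.
set c := dot g (psi k).
rewrite [X in 0 <= X](_ : _ = `|g - c *: psi k| ^+ 2) ?sqr_ge0//.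
rewrite dot_norm dotBl dotZl 2![dot _ (g - _)]dotC !dotBl !dotZl psiE eqxx.
by rewrite mulr1 (dotC (psi k)) -/c subrr mulr0 subr0 expr2.
Qed.

Lemma coef_continuous k : continuous (fun g => dot g (psi k)).
Proof.
move=> g; apply/cvgrPdist_lt => e e0.
have : \forall h \near g, `|g - h| < e.
  by apply: cvgr_dist_lt => //; exact: cvg_id.
apply: filterS => h; apply: le_lt_trans.
by rewrite -dotBl; exact: normr_coef_le.
Qed.

Lemma coef_sum (a : nat -> R) n k :
  dot (\sum_(i < n) a i *: psi i) (psi k) = if (k < n)%N then a k else 0.
Proof.
elim: n => [|n IHn]; first by rewrite big_ord0 ltn0 linear0l.
rewrite big_ord_recr/= dotDl IHn dotZl psiE.
rewrite [(k < n.+1)%N]ltnS [(k <= n)%N]leq_eqVlt [k == n]eq_sym.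
by case: eqVneq => [->|_] /=; rewrite ?ltnn ?mulr1 ?add0r// mulr0 addr0.
Qed.

Lemma normr_sum_psi (a : nat -> R) n :
  `|\sum_(i < n) a i *: psi i| ^+ 2 = \sum_(i < n) a i ^+ 2.
Proof.
rewrite dot_norm linear_sumr; apply: eq_bigr => i _.
by rewrite /= dotZr coef_sum ltn_ord expr2.
Qed.

(** By Parseval [|g|^2] is the limit of sums of squared coefficients, and each square is at most [b]
    times the modulus. *)
Lemma sqr_norm_le_l1_linfty g b B :
  (forall k, `|dot g (psi k)| <= b) ->
  (forall n, \sum_(k < n) `|dot g (psi k)| <= B) ->
  `|g| ^+ 2 <= b * B.
Proof.
move=> gb gB; have b0 : 0 <= b by apply: le_trans (gb 0).
have [_ /(_ g) gE] := psi_basis.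
have nE : (fun n => `|series (fun k => dot g (psi k) *: psi k) n| ^+ 2)
    @ \oo --> `|g| ^+ 2.
  by apply: cvgM; exact: cvg_norm.
apply: (cvgr_to_le nE); apply: nearW => n.
rewrite /series/= big_mkord (normr_sum_psi (fun k => dot g (psi k))).
apply: le_trans (ler_wpM2l b0 (gB n)); rewrite mulr_sumr.
by apply: ler_sum => k _; rewrite -real_normK ?num_real// expr2 ler_wpM2r.
Qed.

(** The truncated l1 norm is continuous, convex and at most 1 at each generator, so its sublevel set
    at 1 is closed and convex and contains the closed hull. *)
Lemma A1_l1 f : A1 psi f -> forall n, \sum_(k < n) `|dot f (psi k)| <= 1.
Proof.
move=> fA n; pose l1 g := \sum_(k < n) `|dot g (psi k)|.
have l1c : continuous l1.
  apply: continuous_big => [|i _ g]; first exact: add_continuous.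
  by apply: cvg_norm; exact: coef_continuous.
suff hull1 : convex_hull [set g | exists k, g = psi k \/ g = - psi k]
    `<=` l1 @^-1` [set x | x <= 1].
  have /closureS/(_ f fA) := hull1.
  have /closure_id <- // : closed (l1 @^-1` [set x | x <= 1]).
  by apply: preimage_closed; [move=> g _; exact: l1c|exact: closed_le].
apply: smallest_sub => [x y p|].
  rewrite !inE/= /l1 => x1 y1.
  have p0 : 0 <= p%:num :> R by [].
  have q0 : 0 <= 1 - p%:num :> R by rewrite subr_ge0.
  apply: (@le_trans _ _ (\sum_(k < n) (p%:num * `|dot x (psi k)| +
      (1 - p%:num) * `|dot y (psi k)|))).
    apply: ler_sum => k _.
    rewrite dotDl !dotZl (le_trans (ler_normD _ _))// !normrM.
    by rewrite (ger0_norm p0) (ger0_norm q0).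
  rewrite big_split/= -!mulr_sumr.
  rewrite (le_trans (lerD (ler_wpM2l p0 x1) (ler_wpM2l q0 y1)))//.
  by rewrite !mulr1 addrC subrK.
have l1psi j : l1 (psi j) <= 1.
  rewrite /l1; under eq_bigr do rewrite psiE normr_nat.
  have [jn|nj] := ltnP j n.
    rewrite (bigD1 (Ordinal jn))//= eqxx big1 ?addr0// => i.
    by rewrite -val_eqE/= eq_sym => /negbTE ->.
  rewrite big1// => i _; case: eqP => // ji.
  by have := ltn_ord i; rewrite -ji ltnNge nj.
move=> _ [j [->|->]] /=; first exact: l1psi.
rewrite /l1; under eq_bigr do rewrite linearNl normrN.
exact: l1psi.
Qed.

(** * Residuals of the algorithm *)

Let res f kk m := f - wtga_approx dot psi f kk m.

Lemma coef_residualS f kk m k :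
  dot (res f kk m.+1) (psi k) =
  if k == kk m then 0 else dot (res f kk m) (psi k).
Proof.
rewrite /res/= opprD addrA dotBl dotZl psiE eq_sym.
by case: eqVneq => [->|_]; rewrite ?mulr1 ?subrr// mulr0 subr0.
Qed.

Lemma nonincreasing_coef_residual f kk k :
  {homo (fun m => `|dot (res f kk m) (psi k)|) :
    m n / (m <= n)%N >-> n <= m}.
Proof.
apply: (@homo_leq _ _ (fun x y => y <= x)) => //.
  by move=> y x z yx zy; exact: le_trans zy yx.
by move=> m; rewrite coef_residualS; case: ifP => // _; rewrite normr0.
Qed.

(** Each step moves one modulus from the first sum to the second; an index chosen again moves 0. [N]
    exceeds every index chosen so far, so the truncated sum sees all deletions. *)
Lemma l1_residual_budget f kk m : exists N, forall n, (N <= n)%N ->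
  \sum_(k < n) `|dot (res f kk m) (psi k)| +
  \sum_(j < m) `|dot (res f kk j) (psi (kk j))| =
  \sum_(k < n) `|dot f (psi k)|.
Proof.
elim: m => [|m [N IHm]].
  by exists 0 => n _; rewrite big_ord0 addr0 /res/= subr0.
exists (maxn N (kk m).+1) => n; rewrite geq_max => /andP[Nn kn].
rewrite -IHm// big_ord_recr/= addrA addrAC; congr (_ + _).
rewrite (bigD1 (Ordinal kn))//= coef_residualS eqxx normr0 add0r.
rewrite [RHS](bigD1 (Ordinal kn))//= addrC; congr (_ + _).
apply: eq_bigr => i; rewrite -val_eqE/= => /negbTE ik.
by rewrite coef_residualS ik.
Qed.

(** * Sufficiency of divergence *)

Lemma wtga_cvg_of_l1 (t : nat -> R) f B kk :
  (forall m, 0 <= t m) ->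
  (~ exists C, forall n, \sum_(m < n) t m <= C) ->
  (forall n, \sum_(k < n) `|dot f (psi k)| <= B) ->
  wtga_realization dot psi t f kk ->
  (fun m => `|res f kk m|) @ \oo --> (0 : R).
Proof.
move=> t0 tub fB fkk.
have B0 : 0 <= B by have := fB 0; rewrite big_ord0.
have spent m : \sum_(j < m) `|dot (res f kk j) (psi (kk j))| <= B.
  have [N /(_ _ (leqnn N)) E] := l1_residual_budget f kk m.
  by apply: le_trans (fB N); rewrite -E lerDr sumr_ge0.
have resB m n : \sum_(k < n) `|dot (res f kk m) (psi k)| <= B.
  apply: le_trans (fB n); apply: ler_sum => k _.
  have /= := nonincreasing_coef_residual f kk k 0 m (leq0n m).
  by rewrite {2}/res /= subr0.
have maxP m := coef_max_attained dot_norm psi_basis (res f kk m).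
have max0 m : 0 <= coef_max dot psi (res f kk m).
  by have [j [-> _]] := maxP m.
(* Otherwise every maximum is at least [e], so [e] times each partial sum of [t] is at most [B],
   against [tub]. *)
have small e : 0 < e -> exists m, coef_max dot psi (res f kk m) < e.
  move=> e0; apply: contrapT => /forallNP big; apply: tub.
  exists (B / e) => n; rewrite ler_pdivlMr// mulr_suml.
  apply: le_trans (spent n); apply: ler_sum => j _.
  apply: le_trans (fkk j); rewrite ler_wpM2l//.
  by rewrite leNgt; apply/negP; exact: big.
apply/cvgr0Pnorm_lt => e e0.
(* The [+ 1] keeps the divisor positive when [B = 0]. *)
have d0 : 0 < e ^+ 2 / (B + 1) by rewrite divr_gt0 ?exprn_gt0// ltr_wpDl.
have [m mP] := small _ d0.
exists m => // n /= mn; rewrite normr_id -ltr_sqr ?nnegrE// ?ltW//.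
(* The maximum at step [m] bounds the coefficients at all later steps, as moduli never grow. *)
have [j [jE jP]] := maxP m.
apply: (@le_lt_trans _ _ (coef_max dot psi (res f kk m) * (B + 1))).
  apply: sqr_norm_le_l1_linfty => k.
    by rewrite jE (le_trans _ (jP k))// nonincreasing_coef_residual.
  by rewrite (le_trans (resB n k))// lerDl.
by rewrite -ltr_pdivlMr// ltr_wpDl.
Qed.

(** * Necessity of divergence *)

Lemma wtga_not_cvg (t : nat -> R) C :
  (forall m, 0 <= t m <= 1) -> (forall n, \sum_(m < n) t m <= C) ->
  exists f kk, [/\ A1 psi f, wtga_realization dot psi t f kk &
    ~ ((fun m => `|res f kk m|) @ \oo --> (0 : R))].
Proof.
move=> t01 tC; have t0 m : 0 <= t m by case/andP: (t01 m).
have C0 : 0 <= C by have := tC 0; rewrite big_ord0.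
pose c : R := (1 + C)^-1.
have c0 : 0 < c by rewrite invr_gt0 ltr_pwDl.
pose a k := if k is m.+1 then c * t m else c.
have a0 k : 0 <= a k by case: k => [|m] /=; rewrite ?mulr_ge0// ltW.
have ac k : a k <= c.
  case: k => //= m; rewrite ler_piMr ?(ltW c0)//.
  by case/andP: (t01 m).
have a1 n : \sum_(k < n) a k <= 1.
  case: n => [|n]; first by rewrite big_ord0.
  rewrite big_ord_recl/= -mulr_sumr -[X in X + _]mulr1 -mulrDr.
  by rewrite mulrC ler_pdivrMr ?mul1r ?lerD2l ?tC// ltr_pwDl.
pose u k := a k *: psi k.
(* Absolute convergence, by completeness of [H]. *)
have u_cvg : cvgn (series u).
  apply: normed_cvg.
  apply: nondecreasing_is_cvgn.
    by apply: nondecreasing_series => n _ _; exact: normr_ge0.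
  exists 1 => _ [n _ <-]; rewrite /= /series/= big_mkord.
  apply: le_trans (a1 n); apply: ler_sum => k _.
  by rewrite normrZ norm_psi mulr1 ger0_norm.
pose f := limn (series u).
have fA : A1 psi f.
  apply: (closed_cvg _ (@closed_closure _ _) _ _ u_cvg).
  apply: nearW => n; apply: subset_closure.
  rewrite /series/= big_mkord; apply: convex_hull_sub1sum => //.
    (* 0 is the midpoint of [psi 0] and [- psi 0]. *)
    rewrite [0](_ : _ = 2^-1 *: psi 0 + (1 - 2^-1) *: - psi 0).
      apply: convex_hull_conv.
      - by rewrite invr_ge0 ler0n invf_le1 ?ler1n.
      - by move=> D [_ AD]; apply: AD; exists 0; left.
      - by move=> D [_ AD]; apply: AD; exists 0; right.
    by rewrite scalerN {2}(splitr 1) div1r addrK subrr.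
  by move=> i; exists i; left.
have fE k : dot f (psi k) = a k.
  have fk : (fun n => dot (series u n) (psi k)) @ \oo --> dot f (psi k).
    exact: (cvg_comp _ _ u_cvg (coef_continuous k f)).
  (* The k-th coefficient of the partial sums is constant from [n = k + 1] on. *)
  rewrite -(cvg_lim _ fk)//; apply: lim_near_cst => //.
  exists k.+1 => // n /= kn.
  by rewrite /series/= big_mkord coef_sum kn.
have rE m k :
    dot (res f S m) (psi k) = if (0 < k <= m)%N then 0 else a k.
  elim: m => [|m IHm].
    by rewrite /res/= subr0 fE; case: k.
  rewrite coef_residualS IHm; case: eqVneq => [->|]; first by rewrite leqnn.
  by rewrite [(k <= m.+1)%N]leq_eqVlt ltnS => /negbTE ->.
(* The choice [S] skips index 0. At step [m] it picks the coefficient [c * t m], while no residual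
   coefficient exceeds [c]. *)
exists f, S; split => //.
  move=> m /=; rewrite -/(res f S m) rE ltnn andbF ger0_norm ?a0//=.
  rewrite mulrC ler_wpM2r//.
  have [j [-> _]] := coef_max_attained dot_norm psi_basis (res f S m).
  by rewrite rE; case: ifP => _; rewrite ?normr0 ?ger0_norm// ltW.
(* The residual norm is at least its coefficient [c] at index 0. *)
move=> r0; suff : c <= 0 by rewrite leNgt c0.
apply: (cvgr_to_ge r0); apply: nearW => m.
by rewrite (le_trans _ (normr_coef_le _ 0))// rE /= ger0_norm// ltW.
Qed.

End OrthonormalBasis.

Theorem theorem4p1 (R : realType) (H : completeNormedModType R)
    (dot : {dot H for idfun}) (psi : nat -> H) (t : nat -> R)
    (dot_norm : induces_norm dot)
    (psi_basis : orthonormal_basis dot psi)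
    (t01 : forall m : nat, 0 <= t m <= 1) :
  (\sum_(0 <= m <oo) (t m)%:E = +oo)%E
  <->
  (forall f : H, A1 psi f ->
   forall kk : nat -> nat, wtga_realization dot psi t f kk ->
   (fun m => `|f - wtga_approx dot psi f kk m|) @ \oo --> (0 : R)).
Proof.
have t0 m : 0 <= t m by case/andP: (t01 m).
apply: (iff_trans (nneseries_pinftyP _ _ t0)); split => [tub f fA kk fkk|cvg].
  exact: (wtga_cvg_of_l1 dot_norm psi_basis t f 1 kk t0 tub
    (A1_l1 dot_norm psi_basis f fA) fkk).
move=> [C tC].
have [f [kk [fA fkk]]] := wtga_not_cvg dot_norm psi_basis t C t01 tC.
by apply; exact: cvg.
Qed.
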